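(* Let $(S,+)$ be a commutative monoid with identity element $0$ and let $\alpha\in\mathrm{Aut}(S,+)$ satisfy $\alpha^2=1$. Define a product on $S$ by $a\cdot b:=\alpha(a)+b$ for all $a,b\in S$. Then $(S,\cdot)$ is an AG-monoid. Furthermore, every AG-monoid can be obtained in this way from a unique pair: for every AG-monoid $(S,\cdot)$ there exist a unique commutative monoid structure $(S,+)$ on the same underlying set $S$ and a unique $\alpha\in\mathrm{Aut}(S,+)$ with $\alpha^2=1$ (i.e. the pair $((S,+),\alpha)$ is unique) such that $a\cdot b=\alpha(a)+b$ for all $a,b\in S$.
   Context: A groupoid is a set with a binary operation (no further axioms assumed). An AG-groupoid is a groupoid $(S,\cdot)$ satisfying the left invertive law $(x\cdot y)\cdot z=(z\cdot y)\cdot x$ for all $x,y,z\in S$. An AG-monoid is an AG-groupoid that has a left identity, i.e. an element $e\in S$ with $e\cdot x=x$ for all $x\in S$. A commutative monoid $(S,+)$ is a set with an associative, commutative binary operation having an identity element $0$. $\mathrm{Aut}(S,+)$ is the group of automorphisms of the monoid $(S,+)$ (bijections $S\to S$ preserving $+$, hence fixing $0$), and $1$ in $\alpha^2=1$ denotes the identity map of $S$; the case $\alpha=1$ is allowed. *)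

(* Defs.v *)
From mathcomp Require Import all_boot.

Set Implicit Arguments.
Unset Strict Implicit.
Unset Printing Implicit Defensive.

(* Structures are predicates on an operation over a bare type, rather than
   bundled types, because the same carrier bears both an AG-monoid and a
   commutative monoid structure and uniqueness quantifies over operations. *)

Definition left_invertive (S : Type) (mul : S -> S -> S) : Prop :=
  forall x y z : S, mul (mul x y) z = mul (mul z y) x.

Definition AG_groupoid (S : Type) (mul : S -> S -> S) : Prop :=
  left_invertive mul.

Definition AG_monoid (S : Type) (mul : S -> S -> S) : Prop :=
  AG_groupoid mul /\ exists e : S, left_id e mul.

(* The identity element is determined by [add], so it is not separate data. *)
Definition commutative_monoid (S : Type) (add : S -> S -> S) : Prop :=
  [/\ associative add, commutative add
    & exists zero : S, left_id zero add /\ right_id zero add].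

Definition automorphism (S : Type) (add : S -> S -> S) (alpha : S -> S) : Prop :=
  bijective alpha /\ {morph alpha : a b / add a b}.

Definition twisted_product (S : Type) (add : S -> S -> S) (alpha : S -> S)
    : S -> S -> S :=
  fun a b => add (alpha a) b.

(* Main.v *)
(** In an AG-monoid with left identity [e], take [alpha a = a * e] and
    [a + b = (a * e) * b].  Left invertivity gives [(a * e) * e = a] and the
    commutativity of [+]; associativity comes from the medial law through
    [a * (b * c) = b * (a * c)].  Conversely, for any pair inducing the product
    the zero is the left identity [e], so [alpha a = alpha a + e = a * e] and
    [a + b = alpha (alpha a) + b = (a * e) * b] are forced. *)

Require Import Defs.
From mathcomp Require Import all_boot.
From Stdlib Require Import FunctionalExtensionality.

(** The image of [zero] is neutral for everything in the image of [alpha], which by surjectivity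
    contains [zero] itself. *)
Lemma automorphism_fix_zero (S : Type) (add : S -> S -> S) (alpha : S -> S)
    (zero : S) :
  left_id zero add -> right_id zero add -> automorphism add alpha ->
  alpha zero = zero.
Proof.
move=> add0x addx0 [[beta alphaK betaK] alphaD].
by rewrite -[LHS]addx0 -{2}(betaK zero) -alphaD add0x betaK.
Qed.

(** Since [alpha] is additive and involutive, [(x * y) * z] expands to [x + alpha y + z], which is
    symmetric in [x] and [z]. *)
Lemma twisted_product_AG_monoid (S : Type) (add : S -> S -> S)
    (alpha : S -> S) :
  commutative_monoid add -> automorphism add alpha -> alpha \o alpha =1 id ->
  AG_monoid (twisted_product add alpha).
Proof.
move=> [addA addC [zero [add0x addx0]]] autA alphaK.
have alpha0 := automorphism_fix_zero _ _ _ _ add0x addx0 autA.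
split; last by exists zero => x; rewrite /twisted_product alpha0.
move=> x y z; rewrite /twisted_product !autA.2.
have alpha2 u : alpha (alpha u) = u by exact: alphaK.
by rewrite !alpha2 addC (addC x) addA.
Qed.

Section AGMonoid.

Variables (S : Type) (mul : S -> S -> S) (e : S).
Hypotheses (mulLI : left_invertive mul) (mul1x : left_id e mul).

(** Three left inversions: [(ab)(cd) = ((cd)b)a = ((bd)c)a = (ac)(bd)]. *)
Lemma AG_medial a b c d :
  mul (mul a b) (mul c d) = mul (mul a c) (mul b d).
Proof. by rewrite mulLI (mulLI c) mulLI. Qed.

Lemma AG_left_commutative : left_commutative mul.
Proof.
(* With [a] written as [ea], the medial law turns [(ea)(bc)] into [(eb)(ac)]. *)
by move=> a b c; rewrite -{1}(mul1x a) AG_medial mul1x.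
Qed.

Definition AG_twist (a : S) : S := mul a e.

Definition AG_add (a b : S) : S := mul (AG_twist a) b.

Lemma AG_twistK : involutive AG_twist.
Proof. by move=> a; rewrite /AG_twist mulLI !mul1x. Qed.

Lemma AG_addC : commutative AG_add.
Proof. by move=> a b; rewrite /AG_add /AG_twist mulLI. Qed.

Lemma AG_addA : associative AG_add.
Proof.
(* Commutativity brings the goal to [a + (c + b) = c + (a + b)], a swap of the left factors [ae] and
   [ce]. *)
move=> a b c; rewrite (AG_addC (AG_add a b)) (AG_addC b).
exact: AG_left_commutative.
Qed.

Lemma AG_add_commutative_monoid : commutative_monoid AG_add.
Proof.
have add0x : left_id e AG_add by move=> b; rewrite /AG_add /AG_twist !mul1x.
split; [exact: AG_addA | exact: AG_addC | exists e; split=> // a].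
by rewrite AG_addC.
Qed.

Lemma AG_twist_automorphism : automorphism AG_add AG_twist.
Proof.
split=> [|a b]; first exact: inv_bij AG_twistK.
(* As [((ae)b)e = (eb)(ae) = b(ae)], what remains is [b(ae) = a(be)]. *)
rewrite {2}/AG_add AG_twistK {1}/AG_twist /AG_add mulLI mul1x.
exact: AG_left_commutative.
Qed.

Lemma AG_mulE a b : mul a b = twisted_product AG_add AG_twist a b.
Proof. by rewrite /twisted_product /AG_add AG_twistK. Qed.

Lemma twisted_product_unique (add : S -> S -> S) (alpha : S -> S) :
  commutative_monoid add -> automorphism add alpha -> alpha \o alpha =1 id ->
  (forall a b, mul a b = twisted_product add alpha a b) ->
  alpha =1 AG_twist /\ add =2 AG_add.
Proof.
move=> [_ _ [zero [add0x addx0]]] autA alphaK mulE.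
have alpha0 := automorphism_fix_zero _ _ _ _ add0x addx0 autA.
(* Evaluate the product at [zero]: [alpha e = alpha e + zero = e * zero = zero]. Applying [alpha]
   again then identifies [e] with [zero]. *)
have alpha_e : alpha e = zero by rewrite -[LHS]addx0 -[LHS]mulE mul1x.
have e0 : e = zero by rewrite -[e]alphaK /= alpha_e alpha0.
have alphaE : alpha =1 AG_twist.
  by move=> a; rewrite /AG_twist mulE /twisted_product e0 addx0.
split=> // a b.
by rewrite /AG_add -alphaE mulE /twisted_product [alpha _]alphaK.
Qed.

End AGMonoid.

Theorem theorem1 (S : Type) :
  (forall (add : S -> S -> S) (alpha : S -> S),
     commutative_monoid add ->
     automorphism add alpha ->
     alpha \o alpha =1 id ->
     AG_monoid (twisted_product add alpha))
  /\
  (forall mul : S -> S -> S,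
     AG_monoid mul ->
     exists! p : (S -> S -> S) * (S -> S),
       [/\ commutative_monoid p.1,
           automorphism p.1 p.2,
           p.2 \o p.2 =1 id
         & forall a b : S, mul a b = twisted_product p.1 p.2 a b]).
Proof.
split=> [add alpha|mul [mulLI [e mul1x]]]; first exact: twisted_product_AG_monoid.
exists (AG_add S mul e, AG_twist S mul e); split=> [|[add alpha] /=].
  split; [exact: AG_add_commutative_monoid | exact: AG_twist_automorphism | |].
    exact: AG_twistK.
  exact: AG_mulE.
case=> monA autA alphaK mulE.
have [alphaE addE] :=
  twisted_product_unique S mul e mul1x add alpha monA autA alphaK mulE.
(* [exists!] asks for Leibniz equality of pairs of functions, so the pointwise equalities are lifted
   by extensionality. *)
congr pair; last by apply: functional_extensionality => a.
apply: functional_extensionality => a.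
by apply: functional_extensionality => b.
Qed.
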